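(* If $\alpha$ is not $C^{1+\epsilon}$, then $\alpha$ is nowhere differentiable and it is not a Lipschitz function on any measurable subset $A\subset\mathbb{S}^1$ with $\mu(A)>0$.
   Context: Identify $\mathbb{S}^1$ with $\mathbb{R}/\mathbb{Z}$ via $t\mapsto(\cos 2\pi t,\sin 2\pi t)$; functions on $\mathbb{S}^1$ are identified with $1$-periodic functions on $\mathbb{R}$. Fix $\epsilon\in(0,1)$; $C^{k+\epsilon}$ means $C^k$ with $\epsilon$-Hölder $k$-th derivative. Let $f:\mathbb{S}^1\to\mathbb{S}^1$ be a $C^{2+\epsilon}$ expanding map, i.e. there is $\lambda>1$ with $|Df(x)|>\lambda$ for every $x$, and let $v:\mathbb{S}^1\to\mathbb{R}$ be a $C^{1+\epsilon}$ function. The generalized Weierstrass function $\alpha:\mathbb{S}^1\to\mathbb{R}$ is $$\alpha(y)=-\sum_{n=1}^{\infty}\frac{v(f^{n-1}(y))}{Df^n(y)},$$ where $f^n$ is the $n$-th iterate of $f$; it is the unique bounded solution of $v(x)=\alpha(f(x))-Df(x)\alpha(x)$. Let $\mu$ be the unique $f$-invariant Borel probability absolutely continuous with respect to Lebesgue measure. *)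

(* Defs.v *)
From HB Require Import structures.
From mathcomp Require Import all_boot all_order all_algebra.
From mathcomp Require Import generic_quotient ring_quotient.
From mathcomp Require Import all_classical all_reals all_analysis.
From mathcomp Require Import measurable_realfun.

Set Implicit Arguments.
Unset Strict Implicit.
Unset Printing Implicit Defensive.

Import Order.TTheory GRing.Theory Num.Theory.
Import numFieldNormedType.Exports.

Local Open Scope classical_set_scope.
Local Open Scope ring_scope.
Local Open Scope quotient_scope.

Definition integers (R : realType) : {pred R} := [pred x | x \is a Num.int].

Lemma integers_zmod_closed (R : realType) : zmod_closed (@integers R).
Proof.
split; first by rewrite inE; exact: int_num0.
by move=> x y; rewrite !inE; exact: rpredB.
Qed.

HB.instance Definition _ (R : realType) :=
  GRing.isZmodClosed.Build R (@integers R) (@integers_zmod_closed R).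

(* The circle R/Z, as an additive group with the quotient topology. *)
Definition circle (R : realType) : Type := Quotient.quot (@integers R).

HB.instance Definition _ (R : realType) :=
  Topological.copy (circle R) (quotient_topology (Quotient.quot (@integers R))).
HB.instance Definition _ (R : realType) := Quotient.on (circle R).
HB.instance Definition _ (R : realType) :=
  isPointed.Build (circle R) (\pi_(circle R) 0).
HB.instance Definition _ (R : realType) := GRing.Zmodule.on (circle R).

Section circle.
Context {R : realType}.
Local Notation S1 := (circle R).
Implicit Types (f : S1 -> S1) (v g : S1 -> R) (x y : S1) (eps : R).

Definition circle_pi (t : R) : S1 := \pi_S1 t.

Lemma circle_pi_eq (s t : R) : circle_pi s = circle_pi t <-> s - t \is a Num.int.
Proof.
have := Quotient.idealrBE (@integers R) s t; rewrite inE => ->.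
by split=> [st|/eqP //]; apply/eqP.
Qed.

Lemma circle_piD (s t : R) : circle_pi (s + t) = circle_pi s + circle_pi t.
Proof. exact: raddfD. Qed.

(* The representative of x in [-1/2, 1/2); it serves as a chart at 0, and
   y |-> signed_repr (y - x) as a chart at x. *)
Definition signed_repr (x : S1) : R :=
  let t : R := repr x in t - (Num.floor (t + 2^-1))%:~R.

(* Arc length, normalised so that the circle has length 1; it is bi-Lipschitz
   equivalent to the chordal distance of the unit circle. *)
Definition circle_dist (x y : S1) : R := `|signed_repr (x - y)|.

Definition C_holder (k : nat) (eps : R) (F : R -> R) : Prop :=
  (forall (j : nat) (t : R), (j < k)%N -> derivable (derive1n j F) t 1) /\
  (exists C : R, forall s t : R,
     `|derive1n k F s - derive1n k F t| <= C * `|s - t| `^ eps).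

Definition circle_fun_C (k : nat) (eps : R) (g : S1 -> R) : Prop :=
  C_holder k eps (fun t => g (circle_pi t)).

(* Regularity of a circle map is that of a lift to R; meant for 1 <= k, since
   the k-th derivative of a lift is then periodic. *)
Definition circle_map_C (k : nat) (eps : R) (f : S1 -> S1) : Prop :=
  exists2 F : R -> R, forall t, circle_pi (F t) = f (circle_pi t) & C_holder k eps F.

(* The derivative of a circle map, computed in the charts at x and f x. *)
Definition Dcircle (f : S1 -> S1) (x : S1) : R :=
  derive1 (fun h : R => signed_repr (f (x + circle_pi h) - f x)) 0.

Definition expanding (f : S1 -> S1) : Prop :=
  exists2 lambda : R, 1 < lambda & forall x, lambda < `|Dcircle f x|.

Definition weierstrass (f : S1 -> S1) (v : S1 -> R) (y : S1) : R :=
  - (\big[+%R/0]_(1 <= n <oo) (v (iter n.-1 f y) / Dcircle (iter n f) y)).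

Definition circle_derivable (g : S1 -> R) (x : S1) : Prop :=
  derivable (fun h : R => g (x + circle_pi h)) 0 1.

Definition lipschitz_in (A : set S1) (g : S1 -> R) : Prop :=
  exists L : R, forall x y, A x -> A y -> `|g x - g y| <= L * circle_dist x y.

End circle.

Definition borel_circle (R : realType) : Type :=
  g_sigma_algebraType (@open (circle R)).

HB.instance Definition _ (R : realType) := Measurable.on (borel_circle R).

Lemma measurable_circle_pi (R : realType) :
  measurable_fun [set: R] (circle_pi : R -> borel_circle R).
Proof.
apply: (@measurability _ _ _ (borel_circle R) [set: R] _
  (@open (circle R))) => //.
move=> _ [U oU <-]; rewrite setTI; apply: open_measurable.
by have /continuousP := @pi_continuous R (Quotient.quot (@integers R)); exact.
Qed.

Definition circle_lebesgue (R : realType) : set (borel_circle R) -> \bar R :=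
  pushforward (mrestr (@lebesgue_measure R) (measurable_itv `[0%R, 1%R[))
    (circle_pi : R -> borel_circle R).

Arguments circle_lebesgue : clear implicits.

Definition invariant_measure (R : realType) (f : circle R -> circle R)
    (mu : set (borel_circle R) -> \bar R) : Prop :=
  forall A : set (borel_circle R), measurable A -> mu (f @^-1` A) = mu A.

(* Main.v *)
Require Import Defs.
From mathcomp Require Import all_boot all_order all_algebra.
From mathcomp Require Import all_classical all_reals all_analysis.
From mathcomp Require Import measurable_realfun.
From mathcomp Require Import ring lra zify.
Import Order.TTheory GRing.Theory Num.Theory.
Import numFieldNormedType.Exports.
Local Open Scope classical_set_scope.
Local Open Scope ring_scope.

(** Write [F] for a lift of [f] to the line, [w] and [a] for the 1-periodic
functions induced by [v] and by the Weierstrass function, so that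
[a (F t) = w t + F' t * a t]. Let [Q s t] be the difference quotient of [a]
between [s] and [t]. Dividing the difference of the equation at two points by
[F s - F t] shows that [Q] is almost a cocycle:
[Q (F s) (F t) = Q s t + phi t + O(|s - t|^eps)] with
[phi = (w' + F'' a) / F'] (lemma [slope_lift]); the error is that small because
[a] is eps-Holder a priori (lemma [holder_weierstrass]). When two pairs of
points are compared, [phi] only contributes its oscillation, and since inverse
branches contract, the errors along an orbit form a geometric series. Hence,
uniformly in [n], the difference between the quotients of two pairs at scale 1
equals the difference between the quotients of their preimages under [F^n], up
to a constant times the [eps]-th power of the diameter (lemma [slope_iter]).

Suppose that there are intervals on which [a] is affine up to an error that is
an arbitrarily small fraction of their length (predicate [almost_affine]). Such
an interval is expanded by some [F^n] to an interval that covers a full period,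
with bounded distortion ([distortion_iter], [blow_up]). The quotients of the preimages then nearly agree, so any two quotients at scale
1 differ by at most a constant times the [eps]-th power of the diameter
([slope_holder]), and this makes [a] of class C^(1+eps)
([C_holder_of_slopes]). It therefore suffices to see that either of the two
properties excluded by the theorem makes [a] almost affine.

If [a] is differentiable at one point, the intervals centred there will do.
If [a] is Lipschitz on a set of positive measure, then that set has positive
Lebesgue measure, and near one of its density points it is nearly dense in small
intervals ([dense_of_positive_measure]). Blowing such an interval up bounds all
quotients at scale 1 in terms of the quotient over one full period, which is
bounded because [a] is, so [a] is Lipschitz on the whole line
([lipschitz_of_dense]). A Lipschitz function is almost affine: on an interval
of length at most 1 whose quotient nearly attains the supremum over such
intervals, the increments must follow that slope closely
([almost_affine_of_lipschitz]). *)

(** * Calculus on the real line *)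

Lemma is_derive_continuous {R : realType} (g g1 : R -> R) :
  (forall x : R, is_derive x (1 : R) g (g1 x)) -> continuous g.
Proof.
move=> dg x; apply/differentiable_continuous/derivable1_diffP.
exact: (@ex_derive _ _ _ _ _ _ _ (dg x)).
Qed.

Lemma mean_value {R : realType} (g g1 : R -> R) (s t : R) :
  (forall x : R, is_derive x (1 : R) g (g1 x)) ->
  exists c, [/\ `|c - s| <= `|s - t|, `|c - t| <= `|s - t|
    & g s - g t = g1 c * (s - t)].
Proof.
move=> dg.
have main p q : p <= q -> exists c, [/\ p <= c, c <= q & g q - g p = g1 c * (q - p)].
  move=> pq; have [|c] := @MVT_segment _ g g1 p q pq.
    exact/continuous_subspaceT/is_derive_continuous.
  by rewrite in_itv /= => /andP[pc cq] e; exists c.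
have [st|/ltW ts] := leP s t.
  have [c [sc ct e]] := main _ _ st; exists c; split.
  - by rewrite ger0_norm ?ler0_norm; lra.
  - by rewrite !ler0_norm; lra.
  by rewrite -opprB e; ring.
have [c [sc ct e]] := main _ _ ts; exists c; split => //.
- by rewrite ler0_norm ?ger0_norm; lra.
- by rewrite !ger0_norm; lra.
Qed.

(** A bounded Lipschitz function is Holder of every exponent below 1, at all
distances: the Lipschitz bound is used below distance 1 and the uniform bound
above it. *)
Lemma le_powR_interpolation {R : realType} (e B d x : R) :
  0 < e < 1 -> 0 <= d -> 0 <= B ->
  x <= B * d -> x <= 2 * B -> x <= 2 * B * d `^ e.
Proof.
move=> /andP[e0 e1]; rewrite le_eqVlt => /predU1P[<-|d0] B0 xd xB.
  by rewrite powR0 ?gt_eqF //; lra.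
have [d1|/ltW d1] := leP d 1.
  apply: (le_trans xd).
  have : d <= d `^ e by apply: ger1_powR; [rewrite d0|exact: ltW].
  nra.
have : 1 <= d `^ e by rewrite -(powRr0 d) ler_powR // ltW.
nra.
Qed.

Lemma powR_le_root {R : realType} (e x y : R) :
  0 < e -> 0 <= x -> 0 <= y -> x <= y `^ e^-1 -> x `^ e <= y.
Proof.
move=> e0 x0 y0 xy; rewrite -[leRHS](powRr1 y0) -(mulVf (lt0r_neq0 e0)) powRrM.
by apply: ge0_ler_powR; rewrite ?nnegrE ?powR_ge0 ?(ltW e0).
Qed.

Lemma normrM_le {R : realType} (x y A C : R) :
  `|x| <= A -> `|y| <= C -> `|x * y| <= A * C.
Proof. by move=> xA yC; rewrite normrM ler_pM. Qed.

Lemma exprn_unbounded {R : realType} (l M : R) :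
  1 < l -> exists n, M <= l ^+ n.
Proof.
move=> l1; have l0 : 0 < l - 1 by rewrite subr_gt0.
have bern n : n%:R * (l - 1) <= l ^+ n.
  elim: n => [|n IH]; first by rewrite mul0r.
  have : 1 <= l ^+ n by apply: exprn_ege1; exact: ltW.
  rewrite -natr1 exprS; nra.
exists (Num.bound `|M / (l - 1)|); apply: le_trans (bern _).
rewrite -ler_pdivrMr //; apply: le_trans (ler_norm _) _.
exact/ltW/archi_boundP/normr_ge0.
Qed.

(** * Difference quotients and the twisted cohomological equation *)

Definition slope {R : realType} (g : R -> R) (s t : R) := (g s - g t) / (s - t).

(** This single property is what differentiability at one point and a global
Lipschitz bound have in common: at some place and scale, the error of an affine
approximation is small relative to the scale. *)
Definition almost_affine {R : realType} (g : R -> R) :=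
  forall eta : R, 0 < eta -> exists p q L : R,
  [/\ p < q, q <= p + 1 & forall s t, p <= s <= q -> p <= t <= q ->
    `|g s - g t - L * (s - t)| <= eta * (q - p)].

(** The situation seen on the line: [F] is a lift of the expanding map, [w] and
[a] are lifts of the two functions on the circle, and [F1], [F2], [w1] are
derivatives. One bound [B] and one Holder constant [H] serve for all the
functions. *)
Record twisted_equation {R : realType} (eps lam B H : R)
    (F F1 F2 w w1 a : R -> R) : Prop := TwistedEquation {
  te_eps : 0 < eps < 1;
  te_lam : 1 < lam;
  te_dF : forall t : R, is_derive t (1 : R) F (F1 t);
  te_dF1 : forall t : R, is_derive t (1 : R) F1 (F2 t);
  te_dw : forall t : R, is_derive t (1 : R) w (w1 t);
  te_expanding : forall t, lam <= `|F1 t|;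
  te_F1_le : forall t, `|F1 t| <= B;
  te_F2_le : forall t, `|F2 t| <= B;
  te_w1_le : forall t, `|w1 t| <= B;
  te_a_le : forall t, `|a t| <= B;
  te_F2_holder : forall s t, `|F2 s - F2 t| <= H * `|s - t| `^ eps;
  te_w1_holder : forall s t, `|w1 s - w1 t| <= H * `|s - t| `^ eps;
  te_equation : forall t, a (F t) = w t + F1 t * a t;
  te_periodic : forall (t : R) (m : int), a (t + m%:~R) = a t }.

Section Renormalization.
Context {R : realType} (eps lam B H : R) (F F1 F2 w w1 a : R -> R).
Context (E : twisted_equation eps lam B H F F1 F2 w w1 a).

Let eps01 := @te_eps _ _ _ _ _ _ _ _ _ _ _ E.
Let lam1 := @te_lam _ _ _ _ _ _ _ _ _ _ _ E.
Let dF := @te_dF _ _ _ _ _ _ _ _ _ _ _ E.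
Let dF1 := @te_dF1 _ _ _ _ _ _ _ _ _ _ _ E.
Let dw := @te_dw _ _ _ _ _ _ _ _ _ _ _ E.
Let expF := @te_expanding _ _ _ _ _ _ _ _ _ _ _ E.
Let bF1 := @te_F1_le _ _ _ _ _ _ _ _ _ _ _ E.
Let bF2 := @te_F2_le _ _ _ _ _ _ _ _ _ _ _ E.
Let bw1 := @te_w1_le _ _ _ _ _ _ _ _ _ _ _ E.
Let ba := @te_a_le _ _ _ _ _ _ _ _ _ _ _ E.
Let hF2 := @te_F2_holder _ _ _ _ _ _ _ _ _ _ _ E.
Let hw1 := @te_w1_holder _ _ _ _ _ _ _ _ _ _ _ E.
Let aF := @te_equation _ _ _ _ _ _ _ _ _ _ _ E.
Let per := @te_periodic _ _ _ _ _ _ _ _ _ _ _ E.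
Let eps0 : 0 < eps. Proof. by case/andP: eps01. Qed.
Let eps1 : eps < 1. Proof. by case/andP: eps01. Qed.
Let B0 : 0 <= B. Proof. exact: le_trans (bw1 0). Qed.
Let lam0 : 0 < lam. Proof. exact: lt_trans lam1. Qed.

Lemma expansion s t : lam * `|s - t| <= `|F s - F t|.
Proof.
have [c [_ _ ->]] := mean_value _ _ s t dF.
by rewrite normrM ler_wpM2r.
Qed.

Lemma lipschitz_lift s t : `|F s - F t| <= B * `|s - t|.
Proof.
have [c [_ _ ->]] := mean_value _ _ s t dF.
by rewrite normrM ler_wpM2r.
Qed.

Lemma expansion_iter n s t : lam ^+ n * `|s - t| <= `|iter n F s - iter n F t|.
Proof.
elim: n => [|n IH]; first by rewrite expr0 mul1r.
rewrite exprS -mulrA; apply: le_trans (expansion _ _).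
by rewrite ler_wpM2l // ltW.
Qed.

(** The mean value [F' xi = (F s - F t) / (s - t)] is used in place of [F' s], so
that the factor gained is exactly [|F' xi|^(eps - 1) <= lam^(eps - 1) < 1],
whatever the ratio between the largest and the smallest expansion. *)
Lemma holder_step :
  let theta := lam `^ (eps - 1) in
  forall K s t, 0 <= K -> s != t -> `|s - t| <= 1 ->
  `|a (F s) - a (F t)| <= K * `|F s - F t| `^ eps ->
  `|a s - a t| <= (K * theta + B + 2 * B * B) * `|s - t| `^ eps.
Proof.
move=> theta K s t K0 st st1 IH.
set d := `|s - t|; have d0 : 0 < d by rewrite normr_gt0 subr_eq0.
have [xi [xs xt eF]] := mean_value _ _ s t dF.
have [z [_ _ ew]] := mean_value _ _ s t dw.
have [c [_ _ ec]] := mean_value _ _ xi s dF1.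
have [c' [_ _ ec']] := mean_value _ _ xi t dF1.
have X0 : 0 < `|F1 xi| by apply: lt_le_trans (expF xi).
have X1 : 1 <= `|F1 xi| by apply: le_trans (expF xi); exact: ltW.
have key : `|F1 xi| * `|a s - a t| <=
    K * `|F s - F t| `^ eps + (B + 2 * B * B) * d.
  rewrite -normrM.
  have -> : F1 xi * (a s - a t) = (a (F s) - a (F t)) - (w s - w t)
     + (F1 xi - F1 s) * a s - (F1 xi - F1 t) * a t by rewrite !aF; ring.
  have := normrM_le _ _ _ _ (normrM_le _ _ _ _ (bF2 c') xt) (ba t).
  have := normrM_le _ _ _ _ (normrM_le _ _ _ _ (bF2 c) xs) (ba s).
  have := normrM_le _ (s - t) _ _ (bw1 z) (lexx _).
  rewrite ew ec ec' => wd cs ct.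
  apply: (le_trans (ler_normB _ _)); apply: le_trans (lerD (ler_normD _ _) ct) _.
  apply: le_trans (lerD (lerD (ler_normB _ _) cs) (lexx _)) _.
  by move: IH wd cs ct; rewrite -/d; lra.
have dd : d <= d `^ eps by apply: ger1_powR; [rewrite d0|exact: ltW].
have eFd : `|F s - F t| `^ eps = `|F1 xi| * `|F1 xi| `^ (eps - 1) * d `^ eps.
  by rewrite eF normrM powRM // mulr_powRB1.
have th : `|F1 xi| `^ (eps - 1) <= theta.
  rewrite /theta -(opprB 1 eps) !powRN lef_pV2 ?posrE ?powR_gt0 //.
  by apply: ge0_ler_powR; rewrite ?nnegrE ?subr_ge0 // ltW.
rewrite -(ler_pM2l X0); apply: (le_trans key); rewrite eFd.
set X := `|F1 xi| in X0 X1 th *; set de := d `^ eps in dd *.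
have de0 : 0 <= de by exact: powR_ge0.
have : K * (X * X `^ (eps - 1) * de) <= X * (K * theta * de).
  have -> : X * (K * theta * de) = K * (X * theta * de) by ring.
  by rewrite ler_wpM2l // ler_wpM2r // ler_wpM2l // ltW.
have : (B + 2 * B * B) * d <= X * ((B + 2 * B * B) * de).
  have BB : 0 <= B + 2 * B * B by rewrite addr_ge0 // !mulr_ge0.
  rewrite mulrCA ler_wpM2l //; apply: (le_trans dd); exact: ler_peMl.
lra.
Qed.

(** The Holder bound holds trivially at distance at least 1 and [holder_step]
carries it from [F s, F t] back to [s, t]; the induction is on the number of
steps that expansion needs to bring two points to distance 1. *)
Lemma holder_weierstrass : exists2 K : R, 0 <= K &
  forall s t, `|a s - a t| <= K * `|s - t| `^ eps.
Proof.
pose theta := lam `^ (eps - 1).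
have th1 : theta < 1.
  rewrite /theta -(opprB 1 eps) powRN invf_lt1 ?powR_gt0 //.
  have : 1 `^ (1 - eps) < lam `^ (1 - eps).
    by apply: gt0_ltr_powR; rewrite ?subr_gt0 ?nnegrE ?ler01 // ltW.
  by rewrite powR1.
pose K := Num.max (2 * B) ((B + 2 * B * B) / (1 - theta)).
have K0 : 0 <= K by rewrite le_max mulr_ge0.
have K1 : K * theta + B + 2 * B * B <= K.
  have : (B + 2 * B * B) / (1 - theta) <= K by rewrite le_max lexx orbT.
  rewrite ler_pdivrMr ?subr_gt0 //; lra.
have far s t : 1 <= `|s - t| -> `|a s - a t| <= K * `|s - t| `^ eps.
  move=> st; have : 1 <= `|s - t| `^ eps.
    by rewrite -(powRr0 `|s - t|) ler_powR // ltW.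
  have : 2 * B <= K by rewrite le_max lexx.
  have := ler_normB (a s) (a t); have := ba s; have := ba t.
  nra.
exists K => // s t; have [->|st] := eqVneq s t.
  by rewrite !subrr normr0 mulr_ge0 // powR_ge0.
have [n] : exists n, 1 <= lam ^+ n * `|s - t|.
  have [n hn] := exprn_unbounded _ `|s - t|^-1 lam1.
  by exists n; rewrite -ler_pdivrMr ?div1r // normr_gt0 subr_eq0.
elim: n s t st => [|n IH] s t st; first by rewrite expr0 mul1r; exact: far.
move=> nst; have [st1|] := leP `|s - t| 1; last by move/ltW; exact: far.
apply: le_trans (holder_step _ _ _ K0 st st1 (IH _ _ _ _)) _.
- rewrite -subr_eq0 -normr_gt0; apply: lt_le_trans (expansion _ _).
  by rewrite mulr_gt0 // normr_gt0 subr_eq0.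
- apply: (le_trans nst); rewrite exprSr -mulrA.
  by rewrite ler_wpM2l ?exprn_ge0 ?expansion // ltW.
by rewrite ler_wpM2r // powR_ge0.
Qed.


Let X1 t : 1 <= `|F1 t|.
Proof. by apply: le_trans (expF t); exact: ltW. Qed.

Let X0 t : 0 < `|F1 t|.
Proof. exact: lt_le_trans (X1 t). Qed.

Let nzF1 t : F1 t != 0.
Proof. by rewrite -normr_gt0. Qed.

Let H0 : 0 <= H.
Proof. by have := le_trans (normr_ge0 _) (hw1 1 0); rewrite subr0 normr1 powR1 mulr1. Qed.

Let le_powR_eps (x y : R) : 0 <= x -> x <= y -> x `^ eps <= y `^ eps.
Proof.
move=> x0 xy; apply: ge0_ler_powR => //; first exact: ltW.
by rewrite nnegrE (le_trans x0).
Qed.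

Lemma holder_F1 s t : `|F1 s - F1 t| <= 2 * B * `|s - t| `^ eps.
Proof.
apply: le_powR_interpolation => //.
  by have [c [_ _ ->]] := mean_value _ _ s t dF1; rewrite normrM ler_wpM2r.
by apply: le_trans (ler_normB _ _) _; rewrite mulr2n mulrDl mul1r lerD.
Qed.

(** If [a] were differentiable, [slope_drift] would be the coboundary of its
derivative: [a' (F t) = a' t + slope_drift t]. *)
Definition slope_drift t := (w1 t + F2 t * a t) / F1 t.

Lemma slope_drift_bounded t : `|slope_drift t| <= B + B * B.
Proof.
rewrite normrM normfV ler_pdivrMr //; apply: le_trans (ler_normD _ _) _.
apply: (@le_trans _ _ (B + B * B)); first by rewrite lerD // normrM_le.
by rewrite ler_peMr // addr_ge0 // mulr_ge0.
Qed.

Lemma slope_drift_holder : exists2 K : R, 0 <= K &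
  forall s t, `|slope_drift s - slope_drift t| <= K * `|s - t| `^ eps.
Proof.
have [K K0 ha] := holder_weierstrass.
pose T := H + B * K + H * B + (B + B * B) * (2 * B).
have T0 : 0 <= T by rewrite !(addr_ge0, mulr_ge0).
exists T => //.
move=> s t; set d := _ `^ eps; have d0 : 0 <= d by exact: powR_ge0.
rewrite -(ler_pM2l (X0 s)) -normrM.
(* Multiplying by [F1 s], of modulus at least 1, clears the denominator. *)
have -> : F1 s * (slope_drift s - slope_drift t) = (w1 s - w1 t)
    + F2 s * (a s - a t) + (F2 s - F2 t) * a t - slope_drift t * (F1 s - F1 t).
  by rewrite /slope_drift; field; rewrite !nzF1.
apply: le_trans (ler_normB _ _) _.
apply: le_trans (lerD (le_trans (ler_normD _ _) (lerD (ler_normD _ _) (lexx _))) (lexx _)) _.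
have e1 := hw1 s t.
have e2 := normrM_le _ _ _ _ (bF2 s) (ha s t).
have e3 := normrM_le _ _ _ _ (hF2 s t) (ba t).
have e4 := normrM_le _ _ _ _ (slope_drift_bounded t) (holder_F1 s t).
apply: le_trans (lerD (lerD (lerD e1 e2) e3) e4) _.
rewrite -/d.
apply: (@le_trans _ _ (T * d)); first by rewrite /T; lra.
by rewrite ler_peMl // mulr_ge0.
Qed.

(** Differentiating the equation formally gives the transformation rule of the
derivative of [a]; for difference quotients it holds up to [O(|s - t|^eps)]. *)
Lemma slope_lift : exists2 C : R, 0 <= C & forall s t, s != t ->
  `|slope a (F s) (F t) - slope a s t - slope_drift t| <= C * `|s - t| `^ eps.
Proof.
have [K K0 ha] := holder_weierstrass.
pose T := B * K + H + H * B + (B + B * B) * (2 * B).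
have T0 : 0 <= T by rewrite !(addr_ge0, mulr_ge0).
exists T => //.
move=> s t st; set d := _ `^ eps; have d0 : 0 <= d by exact: powR_ge0.
have st0 : s - t != 0 by rewrite subr_eq0.
have [xi [xs xt eF]] := mean_value _ _ s t dF.
have [z [_ zt ew]] := mean_value _ _ s t dw.
have [x [_ xt' ex]] := mean_value _ _ s t dF1.
have [c [_ _ ec]] := mean_value _ _ s xi dF1.
rewrite -(ler_pM2l (X0 xi)) -normrM.
have -> : F1 xi * (slope a (F s) (F t) - slope a s t - slope_drift t)
    = (F1 s - F1 xi) * slope a s t + (w1 z - w1 t) + (F2 x - F2 t) * a t
      - slope_drift t * (F1 xi - F1 t).
  have e : a (F s) - a (F t) = (w1 z * (s - t)) + F1 s * (a s - a t)
      + F2 x * (s - t) * a t by rewrite -ew -ex !aF; ring.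
  by rewrite /slope e eF /slope_drift; field; rewrite !nzF1 st0.
(* The quotient may blow up like [|s - t|^(eps - 1)]; the Lipschitz factor
   [F1 s - F1 xi] compensates with a full power of [|s - t|]. *)
have e1 : `|(F1 s - F1 xi) * slope a s t| <= B * (K * d).
  rewrite ec -mulrA; apply: normrM_le => //.
  apply: le_trans (ha s t); rewrite distrC in xs.
  have -> : a s - a t = (s - t) * slope a s t by rewrite /slope mulrC divfK.
  by rewrite !normrM ler_wpM2r.
have e2 := le_trans (hw1 z t) (ler_wpM2l H0 (le_powR_eps _ _ (normr_ge0 _) zt)).
have e3 := normrM_le _ _ _ _ (le_trans (hF2 x t)
  (ler_wpM2l H0 (le_powR_eps _ _ (normr_ge0 _) xt'))) (ba t).
have BB : 0 <= 2 * B by rewrite mulr_ge0.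
have e4 := normrM_le _ _ _ _ (slope_drift_bounded t) (le_trans (holder_F1 xi t)
  (ler_wpM2l BB (le_powR_eps _ _ (normr_ge0 _) xt))).
apply: le_trans (ler_normB _ _) _.
apply: le_trans (lerD (le_trans (ler_normD _ _) (lerD (ler_normD _ _) (lexx _))) (lexx _)) _.
apply: le_trans (lerD (lerD (lerD e1 e2) e3) e4) _.
rewrite -/d.
apply: (@le_trans _ _ (T * d)); first by rewrite /T; lra.
by rewrite ler_peMl // mulr_ge0.
Qed.

(** Comparing two pairs replaces the drift, which is merely bounded, by its
oscillation, which is small with the distance of the pairs. *)
Lemma slope_step : exists2 C : R, 0 <= C & forall (s t s' t' D : R),
  s != t -> s' != t' -> `|s - t| <= D -> `|s' - t'| <= D -> `|t - t'| <= D ->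
  `|(slope a (F s) (F t) - slope a (F s') (F t'))
    - (slope a s t - slope a s' t')| <= C * D `^ eps.
Proof.
have [C C0 hC] := slope_lift; have [K K0 hK] := slope_drift_holder.
exists (C + C + K); first by rewrite !addr_ge0.
move=> s t s' t' D st st' sD sD' tD.
have -> : (slope a (F s) (F t) - slope a (F s') (F t'))
    - (slope a s t - slope a s' t') =
  (slope a (F s) (F t) - slope a s t - slope_drift t) -
  (slope a (F s') (F t') - slope a s' t' - slope_drift t') +
  (slope_drift t - slope_drift t') by ring.
rewrite !mulrDl; apply: le_trans (ler_normD _ _) (lerD _ _).
  apply: le_trans (ler_normB _ _) (lerD _ _).
    by apply: le_trans (hC _ _ st) _; rewrite ler_wpM2l // le_powR_eps.
  by apply: le_trans (hC _ _ st') _; rewrite ler_wpM2l // le_powR_eps.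
by apply: le_trans (hK _ _) _; rewrite ler_wpM2l // le_powR_eps.
Qed.

Let lift_neq s t : s != t -> F s != F t.
Proof.
move=> st; rewrite -subr_eq0 -normr_gt0; apply: lt_le_trans (expansion _ _).
by rewrite mulr_gt0 // normr_gt0 subr_eq0.
Qed.

Lemma iter_lift_neq n s t : s != t -> iter n F s != iter n F t.
Proof. by move=> st; elim: n => //= n; exact: lift_neq. Qed.

Lemma contraction_le n (s t D : R) : `|iter n.+1 F s - iter n.+1 F t| <= D ->
  `|iter n F s - iter n F t| <= D / lam.
Proof.
move=> h; rewrite ler_pdivlMr // mulrC.
exact: le_trans (expansion _ _) h.
Qed.

(** The bound is in terms of the distances of the images under [F^n]: going
backwards they shrink by [1 / lam] at each step, so the errors of [slope_step]
sum to a geometric series with ratio [lam^(- eps)], and the constant does not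
depend on [n]. *)
Lemma slope_iter : exists2 C : R, 0 <= C & forall n (s t s' t' D : R),
  s != t -> s' != t' ->
  `|iter n F s - iter n F t| <= D -> `|iter n F s' - iter n F t'| <= D ->
  `|iter n F t - iter n F t'| <= D ->
  `|(slope a (iter n F s) (iter n F t) - slope a (iter n F s') (iter n F t'))
    - (slope a s t - slope a s' t')| <= C * D `^ eps.
Proof.
have [C C0 hC] := slope_step.
pose rho := (lam `^ eps)^-1.
have rho0 : 0 < rho by rewrite invr_gt0 powR_gt0.
have rho1 : rho < 1.
  rewrite invf_lt1 ?powR_gt0 //.
  have : 1 `^ eps < lam `^ eps by apply: gt0_ltr_powR; rewrite ?nnegrE ?ler01 // ltW.
  by rewrite powR1.
(* [K] is the fixed point of the recursion for the error, [K = rho (C + K)]. *)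
pose K := rho * C / (1 - rho).
have K0 : 0 <= K.
  by apply: divr_ge0; [apply: mulr_ge0 => //; exact: ltW|rewrite subr_ge0 ltW].
have eK : K = rho * C + rho * K.
  by rewrite /K; field; rewrite subr_eq0 gt_eqF.
clearbody K; exists K => //; elim=> [|n IH] s t s' t' D st st' sD sD' tD.
  by rewrite subrr normr0 mulr_ge0 // powR_ge0.
have D0 : 0 <= D := le_trans (normr_ge0 _) sD.
have eD : (D / lam) `^ eps = rho * D `^ eps.
  rewrite mulrC powRM ?invr_ge0 ?(ltW lam0) //; congr (_ * _).
  by rewrite -powR_inv1 ?(ltW lam0) // powRAC powR_inv1 // powR_ge0.
have {}IH := IH s t s' t' _ st st' (contraction_le _ _ _ _ sD)
  (contraction_le _ _ _ _ sD') (contraction_le _ _ _ _ tD).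
have {}hC := hC _ _ _ _ _ (iter_lift_neq n _ _ st) (iter_lift_neq n _ _ st')
  (contraction_le _ _ _ _ sD) (contraction_le _ _ _ _ sD') (contraction_le _ _ _ _ tD).
rewrite eD in IH hC.
rewrite eK; have := lerD hC IH; rewrite !mulrA [C * rho]mulrC [K * rho]mulrC -mulrDl => h.
apply: le_trans h; rewrite -(subrKA (slope a (iter n F s) (iter n F t)
  - slope a (iter n F s') (iter n F t'))); exact: ler_normD.
Qed.

(** The two mean values of [F'] are taken at points at distance at most [3 D],
and [1 + x <= exp x] puts their ratio in a form that multiplies well. *)
Lemma distortion_step (s t u v D : R) :
  `|s - t| <= D -> `|u - v| <= D -> `|s - u| <= D ->
  `|F s - F t| * `|u - v| <= expR (3 * B * D) * (`|F u - F v| * `|s - t|).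
Proof.
move=> stD uvD suD.
have [x [xs _ ->]] := mean_value _ _ s t dF.
have [y [yu _ ->]] := mean_value _ _ u v dF.
have [c [_ _ ec]] := mean_value _ _ x y dF1.
have xy : `|x - y| <= 3 * D.
  rewrite (_ : x - y = (x - s) + (s - u) - (y - u)); last by ring.
  apply: le_trans (ler_normB _ _) _; have := ler_normD (x - s) (s - u).
  lra.
have D0 : 0 <= D := le_trans (normr_ge0 _) stD.
have Fxy : `|F1 x| <= expR (3 * B * D) * `|F1 y|.
  have -> : F1 x = F1 y + F2 c * (x - y) by rewrite -ec; ring.
  apply: le_trans (ler_normD _ _) _.
  have e1 := normrM_le _ _ _ _ (bF2 c) xy.
  have e2 : (1 + 3 * B * D) * `|F1 y| <= expR (3 * B * D) * `|F1 y|.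
    by rewrite ler_wpM2r // expR_ge1Dx.
  have e3 : 3 * B * D <= 3 * B * D * `|F1 y| by rewrite ler_peMr // !mulr_ge0.
  by apply: le_trans (lerD (lexx _) e1) (le_trans _ e2); lra.
have := ler_wpM2r (mulr_ge0 (normr_ge0 (s - t)) (normr_ge0 (u - v))) Fxy.
by rewrite !normrM; lra.
Qed.

(** The sum [3 B D (1 / lam + 1 / lam^2 + ...)] of the exponents of
[distortion_step] along a backward orbit ending at scale [D]. *)
Definition distortion (D : R) := expR (3 * B / (lam - 1) * D).

Lemma distortion_iter n (s t u v D : R) :
  `|iter n F s - iter n F t| <= D -> `|iter n F u - iter n F v| <= D ->
  `|iter n F s - iter n F u| <= D ->
  `|iter n F s - iter n F t| * `|u - v|
    <= distortion D * (`|iter n F u - iter n F v| * `|s - t|).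
Proof.
have [->|st] := eqVneq s t.
  by rewrite !subrr normr0 mul0r !mulr0.
have [->|uv] := eqVneq u v.
  by rewrite !subrr normr0 mulr0 mul0r mulr0.
elim: n D => [|n IH] D stD uvD suD.
  rewrite /= mulrC ler_peMl ?mulr_ge0 // -expR0 ler_expR.
  have D0 : 0 <= D := le_trans (normr_ge0 _) stD.
  by rewrite !mulr_ge0 ?invr_ge0 ?subr_ge0 ?(ltW lam1).
have {}IH := IH _ (contraction_le _ _ _ _ stD) (contraction_le _ _ _ _ uvD)
  (contraction_le _ _ _ _ suD).
have step := distortion_step _ _ _ _ _ (contraction_le _ _ _ _ stD)
  (contraction_le _ _ _ _ uvD) (contraction_le _ _ _ _ suD).
have -> : distortion D = expR (3 * B * (D / lam)) * distortion (D / lam).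
  rewrite -expRD; congr expR; field.
  by rewrite subr_eq0 !gt_eqF.
have P0 : 0 < `|iter n F s - iter n F t|.
  by rewrite normr_gt0 subr_eq0 iter_lift_neq.
have Q0 : 0 < `|iter n F u - iter n F v|.
  by rewrite normr_gt0 subr_eq0 iter_lift_neq.
rewrite -(ler_pM2r (mulr_gt0 Q0 P0)).
apply: le_trans (le_trans (ler_pM _ _ step IH) _); rewrite ?mulr_ge0 //.
  by rewrite le_eqVlt; apply/orP; left; apply/eqP; rewrite !iterS; ring.
by rewrite le_eqVlt; apply/orP; left; apply/eqP; rewrite !iterS; ring.
Qed.

Lemma derivative_same_sign x y : 0 < F1 x * F1 y.
Proof.
wlog xy : x y / x <= y => [hw|].
  by have [/hw//|/ltW/hw] := leP x y; rewrite mulrC.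
rewrite ltNge; apply/negP => neg.
have [|c _ /eqP] := @IVT _ F1 x y 0 xy (continuous_subspaceT (is_derive_continuous _ _ dF1)).
  by case: (leP (F1 x) (F1 y)) => ? /=; apply/andP; split; have := nzF1 x; have := nzF1 y; nra.
by apply/negP.
Qed.

(** The sign of the product expresses that the image of [x] lies between those
of [p] and [q] without telling whether [F^n] preserves orientation. *)
Lemma iter_between n p x q :
  p <= x <= q ->
  0 <= (iter n F x - iter n F p) * (iter n F q - iter n F x).
Proof.
move=> /andP[px xq]; elim: n => [|n IH]; first by rewrite mulr_ge0 ?subr_ge0.
have [c [_ _ e]] := mean_value _ _ (iter n F x) (iter n F p) dF.
have [c' [_ _ e']] := mean_value _ _ (iter n F q) (iter n F x) dF.
rewrite !iterS e e' mulrACA mulr_ge0 //; exact: ltW (derivative_same_sign _ _).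
Qed.

Lemma iter_window n p q x y : p <= x <= q -> p <= y <= q ->
  `|iter n F x - iter n F y| <= `|iter n F q - iter n F p|.
Proof.
move=> /(iter_between n) xb /(iter_between n) yb.
move: xb yb; set P := iter n F p; set Q := iter n F q.
set X := iter n F x; set Y := iter n F y => xb yb.
have [QP|/ltW PQ] := leP Q P.
  have -> : `|Q - P| = P - Q by rewrite ler0_norm ?opprB ?subr_le0.
  rewrite ler_norml.
  have : Q <= X <= P by nra.
  have : Q <= Y <= P by nra.
  by move=> /andP[? ?] /andP[? ?]; apply/andP; split; lra.
have -> : `|Q - P| = Q - P by rewrite ger0_norm ?subr_ge0.
rewrite ler_norml.
have : P <= X <= Q by nra.
have : P <= Y <= Q by nra.
by move=> /andP[? ?] /andP[? ?]; apply/andP; split; lra.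
Qed.

(** The first iterate for which the image of the interval has length at least 2
is taken: its length is then at most [2 B], and an interval of length 2
contains an integer translate of every interval of length 1. *)
Lemma blow_up p q : p < q -> q <= p + 1 -> exists n,
  `|iter n F q - iter n F p| <= 2 * B /\
  forall u : R, exists m : int, forall y : R, u <= y <= u + 1 ->
    exists2 x : R, p <= x <= q & iter n F x = y + m%:~R.
Proof.
move=> pq qp1; pose P n := 2 <= `|iter n F q - iter n F p|.
have exP : exists n, P n.
  have [n hn] := exprn_unbounded _ (2 / (q - p)) lam1.
  exists n; apply: le_trans (expansion_iter _ _ _).
  by rewrite ger0_norm ?subr_ge0 ?(ltW pq) // -ler_pdivrMr ?subr_gt0.
case: (ex_minnP exP) => -[|n] Pn nmin.
  by move: Pn; rewrite /P /= ger0_norm ?subr_ge0 ?(ltW pq) //; lra.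
exists n.+1; split.
  apply: le_trans (lipschitz_lift _ _) _; rewrite mulrC ler_wpM2r //.
  rewrite leNgt; apply/negP => /ltW h; have := nmin n h; by rewrite ltnn.
move=> u; pose P' := iter n.+1 F p; pose Q' := iter n.+1 F q.
exists (Num.ceil (Num.min P' Q' - u)) => y /andP[uy yu].
have := ceil_itv (Num.min P' Q' - u).
move: (Num.ceil _) => m; rewrite intrB /= => /andP[m1 m2].
have PQ : 2 <= Num.max P' Q' - Num.min P' Q'.
  move: Pn; rewrite /P -/P' -/Q'; case: (leP P' Q') => h.
    by rewrite ger0_norm ?subr_ge0.
  by rewrite ler0_norm ?opprB // subr_le0 ltW.
have cont : continuous (iter n.+1 F).
  elim: (n.+1) => [|k IH] x; first exact: cvg_id.
  exact: continuous_comp (IH x) (is_derive_continuous _ _ dF _).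
have [|x] := @IVT _ (iter n.+1 F) p q (y + m%:~R) (ltW pq) (continuous_subspaceT cont).
  by rewrite -/P' -/Q'; apply/andP; split; lra.
by rewrite in_itv /=; exists x.
Qed.

(** Two pairs in a unit interval are pulled back into an interval where [a] is
affine up to a relative error [eta]. By bounded distortion the preimages are
separated by a fixed fraction of that interval, so their quotients agree up to
a multiple of [eta]; [slope_iter] transports this to the given pairs, with an
error that does not depend on [eta], and [eta] tends to 0. *)
Lemma slope_holder : almost_affine a -> exists2 C : R, 0 <= C &
  forall (u s t s' t' D : R),
  u <= s <= u + 1 -> u <= t <= u + 1 -> u <= s' <= u + 1 -> u <= t' <= u + 1 ->
  s != t -> s' != t' -> `|s - t| <= D -> `|s' - t'| <= D -> `|t - t'| <= D ->
  `|slope a s t - slope a s' t'| <= C * D `^ eps.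
Proof.
move=> aff; have [C C0 hC] := slope_iter.
exists C => // u s t s' t' D us ut us' ut' st st' stD sD' tD.
pose K0 := distortion (2 * B) * (2 * B).
have B1 : 0 < B by apply: lt_le_trans (bF1 0).
have K00 : 0 < K0 by rewrite !mulr_gt0 ?expR_gt0.
pose kap : R := Num.min `|s - t| `|s' - t'|.
have kap0 : 0 < kap by rewrite lt_min !normr_gt0 !subr_eq0 st st'.
apply/ler_addgt0Pr => /= de de0.
(* By bounded distortion points whose images are [kap] apart are separated by
   at least [kap / K0] times the length of the interval. *)
pose eta : R := de / 2 * kap / K0.
have eta0 : 0 < eta by rewrite !mulr_gt0 ?invr_gt0.
have [p [q [L [pq qp1 hL]]]] := aff _ eta0.
have [n [W hm]] := blow_up _ _ pq qp1; have {hm}[m hm] := hm u.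
have near x y : p <= x <= q -> p <= y <= q -> x != y ->
    kap <= `|iter n F x - iter n F y| -> `|slope a x y - L| <= de / 2.
  move=> px py xy kxy.
  have xy0 : 0 < `|x - y| by rewrite normr_gt0 subr_eq0.
  have qq : p <= q <= q by rewrite lexx ltW.
  have xyW := le_trans (iter_window n _ _ _ _ px py) W.
  have xqW := le_trans (iter_window n _ _ _ _ px qq) W.
  have dis := distortion_iter _ _ _ _ _ _ xyW W xqW.
  rewrite -(ler_pM2r xy0) -normrM mulrBl [slope _ _ _ * _]divfK ?subr_eq0 //.
  apply: le_trans (hL _ _ px py) _.
  rewrite /eta -(mulrA (de / 2)) -(mulrA (de / 2)) ler_pM2l ?divr_gt0 //.
  rewrite mulrAC ler_pdivrMr //.
  have qp : 0 <= q - p by rewrite subr_ge0 ltW.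
  rewrite (ger0_norm qp) in dis.
  have e1 : kap * (q - p) <= `|iter n F x - iter n F y| * (q - p).
    by rewrite ler_wpM2r.
  have e2 : `|iter n F q - iter n F p| * `|x - y| <= 2 * B * `|x - y|.
    by rewrite ler_wpM2r.
  apply: (le_trans e1); apply: (le_trans dis).
  by rewrite [leRHS]mulrC /K0 -[leRHS]mulrA ler_wpM2l ?expR_ge0.
have [x px ex] := hm _ us; have [y py ey] := hm _ ut.
have [x' px' ex'] := hm _ us'; have [y' py' ey'] := hm _ ut'.
have shift (z z' m' : R) : (z + m') - (z' + m') = z - z' by ring.
have xy : x != y by apply: contra_neq st => exy; apply: (addIr m%:~R); rewrite -ex -ey exy.
have xy' : x' != y' by apply: contra_neq st' => exy; apply: (addIr m%:~R); rewrite -ex' -ey' exy.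
have := hC n x y x' y' D xy xy'.
rewrite ex ey ex' ey' !shift => /(_ stD sD' tD).
rewrite /slope !per !shift -!/(slope _ _ _).
have nxy : `|slope a x y - L| <= de / 2.
  by apply: near => //; rewrite ex ey shift /kap ge_min lexx.
have nxy' : `|slope a x' y' - L| <= de / 2.
  by apply: near => //; rewrite ex' ey' shift /kap ge_min lexx orbT.
move=> h; rewrite (_ : slope a s t - slope a s' t' =
  (slope a s t - slope a s' t' - (slope a x y - slope a x' y'))
  + ((slope a x y - L) - (slope a x' y' - L))); last by ring.
apply: le_trans (ler_normD _ _) (lerD h _).
by apply: le_trans (ler_normB _ _) _; lra.
Qed.

(** Any pair in a unit interval is approximated by images of points of [A], and
its quotient is compared through [slope_iter] with that of a pair approximating
the ends [u], [u + 1] of the unit interval. On the preimages the quotients are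
bounded by [L], and the quotient near [u], [u + 1] is bounded because [a] is
bounded and the two points are far apart. *)
Lemma lipschitz_of_dense (A : set R) (L : R) :
  (forall x y, A x -> A y -> `|a x - a y| <= L * `|x - y|) ->
  (forall sigma : R, 0 < sigma -> exists p q : R, [/\ p < q, q <= p + 1 &
    forall x, p <= x <= q ->
      exists y, [/\ A y, p <= y <= q & `|y - x| <= sigma * (q - p)]]) ->
  exists M : R, forall s t, `|a s - a t| <= M * `|s - t|.
Proof.
move=> lipA dens; have [C C0 hC] := slope_iter; have [K K0 ha] := holder_weierstrass.
pose M := 2 * `|L| + C * (2 * B) `^ eps + 4 * B.
have M0 : 0 <= M by rewrite !(addr_ge0, mulr_ge0) ?powR_ge0.
have B1 : 0 < B by apply: lt_le_trans (bF1 0).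
exists M => s t; have [|st1] := leP 1 `|s - t|.
  move=> st; apply: (@le_trans _ _ (2 * B)).
    by apply: le_trans (ler_normB _ _) _; rewrite mulr2n mulrDl mul1r lerD.
  apply: (@le_trans _ _ M); last by rewrite ler_peMr.
  have : 0 <= 2 * `|L| + C * (2 * B) `^ eps by rewrite !(addr_ge0, mulr_ge0) ?powR_ge0.
  by rewrite /M; lra.
apply/ler_addgt0Pr => /= de de0.
(* [e] is the precision of the approximation; its effect on the difference of
   the values of [a] is at most [de]. *)
have [e [e0 e4 ede]] : exists e : R, [/\ 0 < e, e <= 4^-1 & 2 * M * e + 2 * K * e `^ eps <= de].
  pose x := de / (4 * M + 1); pose y := de / (4 * K + 1).
  have x0 : 0 < x by rewrite divr_gt0 // ltr_wpDl // mulr_ge0.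
  have y0 : 0 < y by rewrite divr_gt0 // ltr_wpDl // mulr_ge0.
  exists (Num.min 4^-1 (Num.min x (y `^ eps^-1))); split.
  - by rewrite !lt_min x0 powR_gt0 // invr_gt0 ltr0n.
  - by rewrite ge_min lexx.
  set e := Num.min _ _.
  have e0 : 0 <= e by rewrite !le_min powR_ge0 (ltW x0) invr_ge0 ler0n.
  have ex : e <= x by rewrite !ge_min lexx !orbT.
  have ey : e `^ eps <= y.
    apply: powR_le_root => //; first exact: ltW.
    by rewrite !ge_min lexx !orbT.
  have ex' : 4 * M * x <= de.
    rewrite /x mulrA ler_pdivrMr ?ltr_wpDl ?mulr_ge0 //; nra.
  have ey' : 4 * K * y <= de.
    rewrite /y mulrA ler_pdivrMr ?ltr_wpDl ?mulr_ge0 //; nra.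
  have := ler_wpM2l M0 ex; have := ler_wpM2l K0 ey; lra.
pose kd := distortion (2 * B) * (2 * B).
have kd0 : 0 < kd by rewrite !mulr_gt0 ?expR_gt0.
have sig0 : 0 < e / kd by rewrite divr_gt0.
have [p [q [pq qp1 hA]]] := dens _ sig0.
have [n [W hm]] := blow_up _ _ pq qp1.
pose u := Num.min s t; have {hm}[m hm] := hm u.
have approx z : u <= z <= u + 1 -> exists x, [/\ A x, p <= x <= q
    & `|iter n F x - (z + m%:~R)| <= e].
  move=> /hm[x px ex]; have [y [Ay py yx]] := hA _ px; exists y; split => //.
  rewrite -ex; have qq : p <= q <= q by rewrite lexx ltW.
  have yxW := le_trans (iter_window n _ _ _ _ py px) W.
  have yqW := le_trans (iter_window n _ _ _ _ py qq) W.
  have dis := distortion_iter _ _ _ _ _ _ yxW W yqW.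
  have qp : 0 < q - p by rewrite subr_gt0.
  rewrite (ger0_norm (ltW qp)) in dis.
  rewrite -(ler_pM2r qp); apply: le_trans dis _.
  apply: (@le_trans _ _ (kd * (e / kd * (q - p)))).
    rewrite /kd -mulrA ler_wpM2l ?expR_ge0 // ler_pM //.
  by rewrite mulrA mulrCA divff ?gt_eqF // mulr1.
have su : u <= s <= u + 1.
  move: st1; rewrite /u; case: (leP s t) => h.
    by rewrite lexx; lra.
  by rewrite ger0_norm ?subr_ge0 ?(ltW h) // => ?; apply/andP; split; lra.
have tu : u <= t <= u + 1.
  move: st1; rewrite /u; case: (leP s t) => h.
    by rewrite ler0_norm ?subr_le0 // => ?; apply/andP; split; lra.
  by rewrite lexx; lra.
have [x [Ax px ex]] := approx _ su; have [y [Ay py ey]] := approx _ tu.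
have [|x' [Ax' px' ex']] := approx u; first by rewrite lexx lerDl ler01.
have [|y' [Ay' py' ey']] := approx (u + 1); first by rewrite lexx lerDl ler01.
have aclose z z' : `|z - (z' + m%:~R)| <= e -> `|a z - a z'| <= K * e `^ eps.
  move=> h; rewrite -(per z' m); apply: le_trans (ha _ _) _.
  by rewrite ler_wpM2l // le_powR_eps.
set X := iter n F x in ex; set Y := iter n F y in ey.
set X' := iter n F x' in ex'; set Y' := iter n F y' in ey'.
have XY : `|a X - a Y| <= M * `|X - Y|.
  have [exy|xy] := eqVneq x y.
    by rewrite /X /Y exy !subrr normr0 mulr0.
  have XY' : 2^-1 <= `|X' - Y'|.
    rewrite (_ : X' - Y' = (X' - (u + m%:~R)) - (Y' - (u + 1 + m%:~R)) - 1); last by ring.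
    rewrite -normrN opprB.
    have := lerB_dist 1 ((X' - (u + m%:~R)) - (Y' - (u + 1 + m%:~R))).
    have := ler_normB (X' - (u + m%:~R)) (Y' - (u + 1 + m%:~R)).
    by rewrite normr1; lra.
  have xy' : x' != y'.
    by apply/eqP => exy; move: XY'; rewrite /X' /Y' exy subrr normr0; lra.
  have sA z z' : A z -> A z' -> z != z' -> `|slope a z z'| <= `|L|.
    move=> Az Az' zz'; rewrite normrM normfV ler_pdivrMr ?normr_gt0 ?subr_eq0 //.
    by apply: le_trans (lipA _ _ Az Az') _; rewrite ler_wpM2r // ler_norm.
  have win z z' : p <= z <= q -> p <= z' <= q ->
     `|iter n F z - iter n F z'| <= 2 * B.
    by move=> pz pz'; apply: le_trans (iter_window _ _ _ _ _ pz pz') W.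
  have := hC n x y x' y' (2 * B) xy xy' (win _ _ px py) (win _ _ px' py') (win _ _ py py').
  rewrite -/X -/Y -/X' -/Y' => h.
  have sX' : `|slope a X' Y'| <= 4 * B.
    rewrite normrM normfV ler_pdivrMr; last by apply: lt_le_trans XY'; rewrite invr_gt0 ltr0n.
    apply: (le_trans (ler_normB _ _)); have := ba X'; have := ba Y'; nra.
  have sX : `|slope a X Y| <= M.
    rewrite (_ : slope a X Y = (slope a X Y - slope a X' Y' - (slope a x y - slope a x' y'))
      + (slope a x y - slope a x' y') + slope a X' Y'); last by ring.
    apply: le_trans (ler_normD _ _) _; apply: le_trans (lerD (ler_normD _ _) (lexx _)) _.
    have := ler_normB (slope a x y) (slope a x' y').
    have := sA _ _ Ax Ay xy; have := sA _ _ Ax' Ay' xy'; rewrite /M; lra.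
  have XY0 : X - Y != 0 by rewrite subr_eq0 iter_lift_neq.
  by move: sX; rewrite normrM normfV ler_pdivrMr // normr_gt0.
have eX := aclose _ _ ex; have eY := aclose _ _ ey.
have XYst : `|X - Y| <= `|s - t| + 2 * e.
  rewrite (_ : X - Y = (s - t) + ((X - (s + m%:~R)) - (Y - (t + m%:~R)))); last by ring.
  apply: le_trans (ler_normD _ _) _; rewrite lerD2l.
  by apply: le_trans (ler_normB _ _) _; lra.
rewrite (_ : a s - a t = (a X - a Y) - ((a X - a s) - (a Y - a t))); last by ring.
apply: le_trans (ler_normB _ _) _.
have := ler_normB (a X - a s) (a Y - a t).
have := ler_wpM2l M0 XYst; lra.
Qed.

End Renormalization.

(** Let the quotient over an interval of length at most 1 be within [eta] of the
supremum of all such quotients. Since the rest of the interval cannot grow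
faster than the supremum allows, the increment over a subinterval falls short
of the slope [sup E] by at most [eta] times the length of the interval. *)
Lemma almost_affine_of_lipschitz {R : realType} (g : R -> R) (M : R) :
  (forall s t, `|g s - g t| <= M * `|s - t|) -> almost_affine g.
Proof.
move=> lip eta eta0.
pose E : set R := [set y | exists s t, [/\ t < s, s <= t + 1 & y = slope g s t]].
have supE : has_sup E.
  split; first by exists (slope g 1 0), 1, 0; split => //; lra.
  exists M => _ [s [t [ts _ ->]]]; apply: le_trans (ler_norm _) _.
  by rewrite normrM normfV ler_pdivrMr // normr_gt0 subr_eq0 gt_eqF.
have [_ [q [p [pq qp1 ->]]] near] := sup_adherent eta0 supE.
exists p, q, (sup E); split => //.
have le_sup s t : p <= t -> t <= s -> s <= q -> g s - g t <= sup E * (s - t).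
  rewrite le_eqVlt => pt; rewrite le_eqVlt => /predU1P[->|ts] sq.
    by rewrite !subrr mulr0.
  rewrite -ler_pdivrMr ?subr_gt0 //; apply: ub_le_sup; first by case: supE.
  by exists s, t; split => //; move: pt => /predU1P[|]; lra.
have ge_sup s t : p <= t -> t <= s -> s <= q ->
    sup E * (s - t) - eta * (q - p) <= g s - g t.
  move=> pt ts sq.
  have := le_sup _ _ (le_trans pt ts) sq (lexx _).
  have := le_sup _ _ (lexx _) pt (le_trans ts sq).
  move: near; rewrite ltr_pdivlMr ?subr_gt0 //; lra.
move=> s t /andP[ps sq] /andP[pt tq].
have eqp : 0 <= eta * (q - p) by rewrite mulr_ge0 ?subr_ge0 // ltW.
rewrite ler_norml; have [st|/ltW ts] := leP s t.
  have := le_sup _ _ ps st tq; have := ge_sup _ _ ps st tq.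
  by move=> ? ?; apply/andP; split; lra.
have := le_sup _ _ pt ts sq; have := ge_sup _ _ pt ts sq.
by move=> ? ?; apply/andP; split; lra.
Qed.

(** * From difference quotients to derivatives *)

Lemma derivable_slope {R : realType} (g : R -> R) (t : R) :
  derivable g t 1 -> forall eta : R, 0 < eta -> exists2 d : R, 0 < d &
    forall h, h != 0 -> `|h| < d -> `|slope g (t + h) t - derive1 g t| <= eta.
Proof.
rewrite derive1E => dg eta eta0.
have /cvgrPdist_le/(_ eta eta0) :
    h^-1 *: ((g \o shift t) (h *: (1 : R)) - g t) @[h --> 0^'] --> 'D_1 g t.
  exact: dg.
move=> /nbhs_ballP[d /= d0 hd]; exists d => // h h0 hd'.
have := hd h; rewrite /ball /= sub0r normrN => /(_ hd' h0).
by rewrite distrC /slope scaler1 addrAC subrr add0r [h + t]addrC mulrC.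
Qed.

Lemma derivable_of_cauchy_slopes {R : realType} (g : R -> R) (t : R) :
  (forall eta : R, 0 < eta -> exists2 d : R, 0 < d &
    forall h h', h != 0 -> h' != 0 -> `|h| < d -> `|h'| < d ->
    `|slope g (t + h) t - slope g (t + h') t| < eta) ->
  derivable g t 1.
Proof.
move=> cau; apply: cauchy_cvg; apply/cauchyP => eta eta0.
have [d d0 hd] := cau _ eta0.
exists (slope g (t + d / 2) t); apply/nbhs_ballP; exists d => //= h.
rewrite /ball /= sub0r normrN => hd' h0.
have := hd (d / 2) h; rewrite gt_eqF ?divr_gt0 // gtr0_norm ?divr_gt0 //.
rewrite [slope g (t + h) t]/slope scaler1 [t + h - t]addrAC subrr add0r.
rewrite [h + t]addrC [_ * h^-1]mulrC.
by apply => //; lra.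
Qed.

Lemma almost_affine_of_derivable {R : realType} (g : R -> R) (t : R) :
  derivable (fun h => g (t + h)) (0 : R) 1 -> almost_affine g.
Proof.
move=> /derivable_slope dg eta eta0.
have eta2 : 0 < eta / 2 by rewrite divr_gt0.
have [d d0 hd] := dg _ eta2.
set L := derive1 _ _ in hd.
have {}hd h : `|h| < d -> `|g (t + h) - g t - L * h| <= eta / 2 * `|h|.
  have [->|h0] := eqVneq h 0; first by rewrite addr0 mulr0 !subrr normr0 mulr0.
  move=> /(hd _ h0); rewrite /slope !add0r subr0 addr0 => hh.
  rewrite -ler_pdivrMr ?normr_gt0 // -normfV -normrM mulrBl mulfK //.
pose r := Num.min (d / 2) 2^-1.
have r0 : 0 < r by rewrite lt_min divr_gt0 // invr_gt0 ltr0n.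
have rd : r <= d / 2 by rewrite ge_min lexx.
have r2 : r <= 2^-1 by rewrite ge_min lexx orbT.
exists (t - r), (t + r), L; split; [lra|lra|move=> x y xr yr].
have close z : t - r <= z <= t + r -> `|g z - g t - L * (z - t)| <= eta / 2 * r.
  move=> /andP[z1 z2]; have zr : `|z - t| <= r by rewrite ler_norml; apply/andP; split; lra.
  have zd : `|z - t| < d by apply: (le_lt_trans zr); lra.
  have := hd (z - t) zd; rewrite (_ : t + (z - t) = z); last by ring.
  by move=> h; apply: (le_trans h); rewrite ler_wpM2l // ltW.
rewrite (_ : _ - _ = (g x - g t - L * (x - t)) - (g y - g t - L * (y - t))); last by ring.
apply: le_trans (ler_normB _ _) _.
by have := mulr_ge0 (ltW eta0) (ltW r0); have := close _ xr; have := close _ yr; lra.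
Qed.

(** The quotients with one fixed end point form a Cauchy family, and the bound
passes to the limit for points at distance at most 1/2. Periodicity makes the
quotient over a full period vanish, so the derivative is bounded, which gives
the bound for distant points. *)
Lemma C_holder_of_slopes {R : realType} (eps C : R) (g : R -> R) :
  0 < eps < 1 -> 0 <= C -> (forall (t : R) (m : int), g (t + m%:~R) = g t) ->
  (forall (u s t s' t' D : R),
    u <= s <= u + 1 -> u <= t <= u + 1 -> u <= s' <= u + 1 -> u <= t' <= u + 1 ->
    s != t -> s' != t' -> `|s - t| <= D -> `|s' - t'| <= D -> `|t - t'| <= D ->
    `|slope g s t - slope g s' t'| <= C * D `^ eps) ->
  C_holder 1 eps g.
Proof.
move=> /andP[eps0 eps1] C0 per hC.
have in_unit (t x : R) : `|x - t| <= 2^-1 -> t - 2^-1 <= x <= t - 2^-1 + 1.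
  by rewrite ler_norml => /andP[h1 h2]; apply/andP; split; lra.
have dg t : derivable g t 1.
  apply: derivable_of_cauchy_slopes => eta eta0.
  pose d := Num.min 2^-1 ((eta / (2 * C + 1)) `^ eps^-1).
  have C1 : 0 < 2 * C + 1 by rewrite ltr_wpDl // mulr_ge0.
  have d0 : 0 < d by rewrite lt_min invr_gt0 ltr0n powR_gt0 // divr_gt0.
  have d2 : d <= 2^-1 by rewrite ge_min lexx.
  exists d => // h h' h0 h0' hd hd'.
  have neq k : k != 0 -> t + k != t by move=> k0; rewrite -subr_eq0 addrAC subrr add0r.
  have tk (k : R) : t + k - t = k by ring.
  apply: le_lt_trans (hC (t - 2^-1) _ _ _ _ d _ _ _ _ (neq _ h0) (neq _ h0') _ _ _) _;
    rewrite ?in_unit ?tk ?subrr ?normr0 ?invr_ge0 ?ler0n ?(ltW d0) ?(ltW hd) ?(ltW hd') //.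
  - by apply: le_trans d2; exact: ltW.
  - by apply: le_trans d2; exact: ltW.
  have : d `^ eps <= eta / (2 * C + 1).
    apply: powR_le_root; rewrite ?(ltW d0) ?divr_ge0 ?(ltW eta0) ?(ltW C1) //.
    by rewrite ge_min lexx orbT.
  rewrite ler_pdivlMr //; have := powR_ge0 d eps; nra.
have bound t : `|derive1 g t| <= C.
  apply/ler_addgt0Pr => /= e e0; have [d d0 hd] := derivable_slope _ _ (dg t) _ e0.
  pose h := Num.min (d / 2) 2^-1.
  have h0 : 0 < h by rewrite lt_min divr_gt0 // invr_gt0 ltr0n.
  have hd2 : h <= d / 2 by rewrite ge_min lexx.
  have h2 : h <= 2^-1 by rewrite ge_min lexx orbT.
  have H1 : `|slope g (t + h) t - derive1 g t| <= e.
    by apply: hd; rewrite ?gt_eqF // gtr0_norm //; lra.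
  have := hC (t - 2^-1) (t + h) t (t - 2^-1 + 1) (t - 2^-1) 1.
  rewrite powR1 mulr1 [slope g _ (t - 2^-1)]/slope (per _ 1) !subrr mul0r subr0.
  rewrite (_ : t + h - t = h); last by ring.
  rewrite (_ : t - 2^-1 + 1 - (t - 2^-1) = 1); last by ring.
  rewrite (_ : t - (t - 2^-1) = 2^-1); last by ring.
  rewrite gtr0_norm // normr1 (@ger0_norm _ 2^-1) //.
  move=> H2.
  have {}H2 : `|slope g (t + h) t| <= C.
    by apply: H2; try (apply/andP; split); try lra; rewrite gt_eqF //; lra.
  rewrite (_ : derive1 g t = slope g (t + h) t - (slope g (t + h) t - derive1 g t)); last by ring.
  by apply: le_trans (ler_normB _ _) (lerD H2 H1).
split; first by move=> [|//] t _; exact: dg.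
exists (4 * C) => s t /=; have [st|st] := leP `|s - t| 2^-1; last first.
  have : 2^-1 <= `|s - t| `^ eps.
    have [d1|/ltW d1] := leP `|s - t| 1.
      apply: (le_trans (ltW st)); apply: ger1_powR; last exact: ltW.
      by rewrite d1 (lt_trans _ st) // invr_gt0 ltr0n.
    apply: (@le_trans _ _ 1); first by lra.
    by rewrite -(powRr0 `|s - t|) ler_powR // ltW.
  have := ler_normB (derive1 g s) (derive1 g t).
  have := bound s; have := bound t; nra.
have [->|neq] := eqVneq s t.
  by rewrite subrr normr0 mulr_ge0 ?powR_ge0 // mulr_ge0.
set D := `|s - t| in st *; have D0 : 0 < D by rewrite normr_gt0 subr_eq0.
apply: (@le_trans _ _ (C * D `^ eps)); last first.
  by rewrite ler_wpM2r ?powR_ge0 //; lra.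
apply/ler_addgt0Pr => /= e e0; have e2 : 0 < e / 2 by rewrite divr_gt0.
have [d d0 hd] := derivable_slope _ _ (dg s) _ e2.
have [d' d0' hd'] := derivable_slope _ _ (dg t) _ e2.
pose h := Num.min (Num.min (d / 2) (d' / 2)) (Num.min D 4^-1).
have h0 : 0 < h by rewrite !lt_min D0 !divr_gt0 // invr_gt0 ltr0n.
have h1 : h <= d / 2 by rewrite !ge_min lexx.
have h2 : h <= d' / 2 by rewrite !ge_min lexx !orbT.
have h3 : h <= D by rewrite !ge_min lexx !orbT.
have h4 : h <= 4^-1 by rewrite !ge_min lexx !orbT.
have nh : h != 0 by rewrite gt_eqF.
have ah : `|h| = h by rewrite gtr0_norm.
have H1 : `|slope g (s + h) s - derive1 g s| <= e / 2 by apply: hd => //; rewrite ah; lra.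
have H2 : `|slope g (t + h) t - derive1 g t| <= e / 2 by apply: hd' => //; rewrite ah; lra.
have tk (x k : R) : x + k - x = k by ring.
have nx x : x + h != x by rewrite -subr_eq0 tk.
have H3 : `|slope g (s + h) s - slope g (t + h) t| <= C * D `^ eps.
  have [us us' ut ut'] : [/\ Num.min s t <= s <= Num.min s t + 1,
      Num.min s t <= s + h <= Num.min s t + 1, Num.min s t <= t <= Num.min s t + 1
      & Num.min s t <= t + h <= Num.min s t + 1].
    move: st h0 h4; rewrite /D ler_norml; clear; move=> /andP[? ?] ? ?.
    by case: (leP s t) => ?; split; apply/andP; split; lra.
  by apply: (hC _ _ _ _ _ _ us' us ut' ut (nx s) (nx t)); rewrite ?tk ?ah.
rewrite (_ : derive1 g s - derive1 g t = (slope g (s + h) s - slope g (t + h) t)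
  - ((slope g (s + h) s - derive1 g s) - (slope g (t + h) t - derive1 g t))); last by ring.
apply: le_trans (ler_normB _ _) (lerD H3 _).
by apply: le_trans (ler_normB _ _) _; lra.
Qed.

(** * Lifts of circle maps *)

Lemma circle_pi_intD {R : realType} (t : R) (m : int) :
  circle_pi (t + m%:~R) = circle_pi t.
Proof. by apply/circle_pi_eq; rewrite addrAC subrr add0r rpred_int_num. Qed.

Lemma circle_pi_surj {R : realType} (x : circle R) : circle_pi (repr x) = x.
Proof. exact: reprK. Qed.

Lemma circle_piB {R : realType} (s t : R) :
  circle_pi s - circle_pi t = circle_pi (s - t).
Proof. by symmetry; exact: raddfB. Qed.

Lemma signed_repr_pi {R : realType} (t : R) : exists m : int,
  signed_repr (circle_pi t) = t + m%:~R /\ - 2^-1 <= t + m%:~R < 2^-1.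
Proof.
rewrite /signed_repr; set r : R := repr (circle_pi t).
have /circle_pi_eq/intrP[k rt] : circle_pi r = circle_pi t by exact: circle_pi_surj.
have -> : t = r - k%:~R by rewrite -rt; ring.
exists (k - Num.floor (r + 2^-1)); rewrite intrB; split; first by ring.
have /andP[] := floor_itv (r + 2^-1); rewrite intrD.
by move=> h1 h2; apply/andP; split; lra.
Qed.

Lemma signed_repr_small {R : realType} (t : R) :
  `|t| < 2^-1 -> signed_repr (circle_pi t) = t.
Proof.
have [m [-> /andP[h1 h2]]] := signed_repr_pi t; rewrite ltr_norml => /andP[h3 h4].
suff -> : m = 0 by rewrite addr0.
have : m < 1 by rewrite -(ltr_int R); lra.
have : -1 < m by rewrite -(ltr_int R); lra.
by lia.
Qed.

Lemma circle_dist_le {R : realType} (s t : R) :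
  circle_dist (circle_pi s) (circle_pi t) <= `|s - t|.
Proof.
rewrite /circle_dist circle_piB.
have [h|h] := ltP `|s - t| 2^-1; first by rewrite signed_repr_small.
have [m [-> /andP[h1 h2]]] := signed_repr_pi (s - t).
by apply: le_trans h; rewrite ler_norml (ltW h2) h1.
Qed.

(** For small [h] the chart at [g x] reads the increment of [g] as the increment
of its lift, because [signed_repr] is the identity on small representatives. *)
Lemma Dcircle_lift {R : realType} (g : circle R -> circle R) (G : R -> R) (t : R) :
  (forall x, circle_pi (G x) = g (circle_pi x)) -> derivable G t 1 ->
  Dcircle g (circle_pi t) = derive1 G t.
Proof.
move=> lift dG; rewrite /Dcircle !derive1E.
have dG0 : is_derive (0 : R) (1 : R) (fun h => G (t + h)) ('D_1 G t).
  rewrite -[X in is_derive _ _ _ X]mulr1.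
  apply: (@is_derive1_comp _ G (fun h => t + h)).
    by rewrite addr0; exact: derivableP.
  rewrite -[X in is_derive _ _ _ X]add0r; exact: is_deriveD.
transitivity ('D_1 (fun h => G (t + h) - G t) (0 : R)); last first.
  have : is_derive (0 : R) (1 : R) (fun h => G (t + h) - G t) ('D_1 G t - 0) by exact: is_deriveB.
  by move=> /@derive_val ->; rewrite subr0.
apply: near_eq_derive.
have cont : {for (0:R), continuous (fun h => G (t + h))}.
  apply/differentiable_continuous/derivable1_diffP; exact: (@ex_derive _ _ _ _ _ _ _ dG0).
have /cvgrPdist_lt/(_ 2^-1) := cont.
rewrite invr_gt0 ltr0n => /(_ isT); apply: filterS => h; rewrite addr0 distrC => hh.
rewrite -circle_piD -!lift -(signed_repr_small _ hh).
by rewrite circle_piB.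
Qed.

Lemma iter_lift {R : realType} (g : circle R -> circle R) (G : R -> R) n x :
  (forall x, circle_pi (G x) = g (circle_pi x)) ->
  circle_pi (iter n G x) = iter n g (circle_pi x).
Proof. by move=> lift; elim: n => //= n <-; rewrite lift. Qed.

Lemma is_derive_iter {R : realType} (G G1 : R -> R) n (t : R) :
  (forall x : R, is_derive x (1 : R) G (G1 x)) ->
  is_derive t (1 : R) (iter n G) (\prod_(k < n) G1 (iter k G t)).
Proof.
move=> dG; elim: n => [|n IH].
  by rewrite big_ord0; exact: is_derive_id.
rewrite big_ord_recr /= mulrC.
exact: (@is_derive1_comp _ G (iter n G)).
Qed.

(** * The Weierstrass series *)

Section WeierstrassSeries.
Context {R : realType} (lam M : R) (F F1 w : R -> R).
Context (lam1 : 1 < lam) (expF : forall t, lam <= `|F1 t|) (bw : forall t, `|w t| <= M).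

(** The product is the derivative of the [n]-th iterate of [F] at [t], by the
chain rule. *)
Definition weierstrass_term (t : R) (n : nat) :=
  w (iter n.-1 F t) / \prod_(k < n) F1 (iter k F t).

Let S t (N : nat) := \sum_(1 <= n < N) weierstrass_term t n.

Let lam0 : 0 < lam. Proof. exact: lt_trans lam1. Qed.
Let M0 : 0 <= M. Proof. exact: le_trans (bw 0). Qed.
Let F1_neq0 t : F1 t != 0.
Proof. by rewrite -normr_gt0; exact: lt_le_trans (expF t). Qed.

Lemma weierstrass_termS t n :
  weierstrass_term t n.+2 = weierstrass_term (F t) n.+1 / F1 t.
Proof.
rewrite /weierstrass_term /= -iterSr iterS big_ord_recl /= invfM mulrA mulrAC.
by congr (_ / _ / _); apply: eq_bigr => k _; rewrite -iterSr.
Qed.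

(** The functional equation at the level of partial sums: the first term is
split off and the other ones come from the sum at [F t]. *)
Lemma weierstrass_sumS t N : S t N.+2 = (w t + S (F t) N.+1) / F1 t.
Proof.
rewrite /S big_nat_recl // mulrDl; congr (_ + _).
  by rewrite /weierstrass_term /= big_ord1.
by rewrite mulr_suml; apply: eq_big_nat => -[//|n] _; rewrite weierstrass_termS.
Qed.

(** [M / (lam - 1)] is the fixed point of [x |-> (M + x) / lam], which bounds the
recursion [weierstrass_sumS]. *)
Lemma weierstrass_sum_bounded t N : `|S t N| <= M / (lam - 1).
Proof.
have l0 : 0 < lam - 1 by rewrite subr_gt0.
have K0 : 0 <= M / (lam - 1) by rewrite divr_ge0 // ltW.
elim: N t => [|[|N] IH] t; [by rewrite /S big_geq ?normr0..|].
rewrite weierstrass_sumS normrM normfV ler_pdivrMr ?normr_gt0 //.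
apply: (@le_trans _ _ (M / (lam - 1) * lam)); last by rewrite ler_wpM2l.
apply: le_trans (ler_normD _ _) _; apply: le_trans (lerD (bw t) (IH (F t))) _.
rewrite le_eqVlt; apply/orP; left; apply/eqP; field.
by rewrite gt_eqF.
Qed.

Lemma weierstrass_sum_cvg t : cvgn (S t).
Proof.
pose u k := weierstrass_term t k.+1.
suff /cvg_ex[l ul] : cvgn (series u).
  apply/cvg_ex; exists l; rewrite -(cvg_shiftS (S t)).
  rewrite (_ : (fun N => S t N.+1) = series u) //.
  by apply/funext => N; rewrite /S /series /= big_add1.
apply: normed_cvg; have il : `|lam^-1| < 1.
  by rewrite normfV invf_lt1 ?normr_gt0 ?gt_eqF // gtr0_norm.
apply: series_le_cvg (is_cvg_geometric_series (a := M) il) => k //=.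
  by rewrite mulr_ge0 // exprn_ge0 // invr_ge0 ltW.
rewrite /u /weierstrass_term normrM normfV exprVn ler_pM ?invr_ge0 //.
have : lam ^+ k <= `|\prod_(j < k.+1) F1 (iter j F t)|.
  rewrite normr_prod big_ord_recl /= -[leLHS]mul1r; apply: ler_pM => //.
  - by rewrite exprn_ge0 // ltW.
  - by apply: le_trans (expF _); exact: ltW.
  - rewrite -[in leLHS](card_ord k) -prodr_const; apply: ler_prod => j _.
    by rewrite expF ltW.
have P0 : 0 < lam ^+ k by rewrite exprn_gt0.
by move=> h; rewrite lef_pV2 // posrE // (lt_le_trans P0 h).
Qed.


Lemma weierstrass_sum_lim t :
  limn (S (F t)) = F1 t * limn (S t) - w t.
Proof.
have cF := weierstrass_sum_cvg (F t).
have : (fun N => (w t + S (F t) N) / F1 t) @ \oo --> (w t + limn (S (F t))) / F1 t.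
  by apply: cvgM; [apply: cvgD; [exact: cvg_cst|exact: cF]|exact: cvg_cst].
rewrite -cvg_shiftS.
under eq_fun do rewrite -weierstrass_sumS.
rewrite (cvg_shiftS (fun n => S t n.+1)) (cvg_shiftS (S t)) => /cvg_lim -> //.
by rewrite mulrC divfK // addrAC subrr add0r.
Qed.

Lemma weierstrass_lim_bounded t : `|limn (S t)| <= M / (lam - 1).
Proof.
rewrite ler_norml; apply/andP; split.
  apply: limr_ge; first exact: weierstrass_sum_cvg.
  by apply: nearW => N; have := weierstrass_sum_bounded t N; rewrite ler_norml => /andP[].
apply: limr_le; first exact: weierstrass_sum_cvg.
by apply: nearW => N; have := weierstrass_sum_bounded t N; rewrite ler_norml => /andP[].
Qed.
End WeierstrassSeries.

(** * Sets of positive measure *)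

Lemma density_interval {R : realType} (A : set R) (delta : R) :
  measurable A -> (0 < lebesgue_measure A)%E -> 0 < delta ->
  exists x r : R, [/\ 0 < r, r <= 2^-1 &
    (((1 - delta) * (r *+ 2))%:E < lebesgue_measure (A `&` ball x r))%E].
Proof.
move=> mA A0 delta0.
have [N [mN N0 subN]] := lebesgue_density mA.
have [x Ax Nx] : exists2 x, A x & ~ N x.
  apply: contrapT => noex; move: A0; rewrite lt_neqAle => /andP[/eqP + _]; apply.
  apply/esym/eqP; rewrite -measure_le0 -N0 le_measure ?inE // => x Ax.
  by apply: contrapT => Nx; apply: noex; exists x.
have {subN} lim : (lebesgue_measure (A `&` ball x r) * (lebesgue_measure (ball x r))^-1)%E
    @[r --> 0^'+] --> (\1_A x)%:E.
  by apply: contrapT => nl; apply: Nx; exact: subN.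
rewrite indicE mem_set //= in lim.
have lt1 : ((1 - delta)%:E < 1)%E by rewrite lte_fin gtrBl.
have near1 : \forall r \near (0:R)^'+,
    ((1 - delta)%:E < lebesgue_measure (A `&` ball x r) * (lebesgue_measure (ball x r))^-1)%E.
  exact: lim _ (open_ereal_gt' lt1).
have nearr : \forall r \near (0:R)^'+, r <= 2^-1.
  by apply: nbhs_right_le; rewrite invr_gt0.
have [r [/= H1 [r2 r0]]] := @filter_ex _ _ _ _ (filterI near1 (filterI nearr (nbhs_right_gt 0))).
exists x, r; split => //; move: H1.
rewrite /= lebesgue_measure_ball ?(ltW r0) //.
have rr0 : 0 < r *+ 2 by rewrite mulrn_wgt0.
rewrite inver gt_eqF // lte_pdivlMr //.
Qed.

(** In a ball around a density point the complement of [A] occupies too small a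
fraction to contain an interval of length [del] times that of the ball. *)
Lemma dense_of_positive_measure {R : realType} (A : set R) :
  measurable A -> (0 < lebesgue_measure A)%E ->
  forall sigma : R, 0 < sigma -> exists p q : R, [/\ p < q, q <= p + 1 &
    forall x, p <= x <= q ->
      exists y, [/\ A y, p <= y <= q & `|y - x| <= sigma * (q - p)]].
Proof.
move=> mA A0 sigma sigma0.
pose del : R := Num.min sigma 2^-1.
have d0 : 0 < del by rewrite lt_min sigma0 invr_gt0 ltr0n.
have ds : del <= sigma by rewrite ge_min lexx.
have d2 : del <= 2^-1 by rewrite ge_min lexx orbT.
have [x [r [r0 r2 Ar]]] := density_interval _ _ mA A0 d0.
exists (x - r), (x + r); split; [lra|lra|move=> z /andP[z1 z2]].
apply: contrapT => noy.
have ell0 : 0 < del * (r *+ 2) by rewrite mulr_gt0 ?mulrn_wgt0.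
have ellr : del * (r *+ 2) <= r by rewrite -mulr_natr; nra.
have ells : del * (r *+ 2) <= sigma * (x + r - (x - r)).
  have -> : x + r - (x - r) = r *+ 2 by ring.
  by rewrite ler_wpM2r // mulrn_wge0 // ltW.
set ell := del * (r *+ 2) in ell0 ellr ells.
(* An interval of length [ell] with an end at [z], on the side of the centre
   so that it stays in the ball. *)
have [c [c1 c2 cz]] : exists c : R, [/\ x - r <= c, c + ell <= x + r
    & forall y, c < y < c + ell -> `|y - z| <= ell].
  have [zx|xz] := leP z x.
    exists z; split; [lra|lra|move=> y /andP[? ?]].
    by rewrite ler_norml; apply/andP; split; lra.
  exists (z - ell); split; [lra|lra|move=> y /andP[? ?]].
  by rewrite ler_norml; apply/andP; split; lra.
pose I : set R := [set` `]c, (c + ell)[].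
have IB : I `<=` ball x r.
  move=> y; rewrite /I /= in_itv /= => /andP[? ?].
  by rewrite /ball /= ltr_norml; apply/andP; split; lra.
have disj : (A `&` ball x r) `&` I = set0.
  rewrite -subset0 => y [[Ay _]]; rewrite /I /= in_itv /= => yc; apply: noy.
  exists y; split => //; last by apply: le_trans ells; exact: cz.
  by move: yc => /andP[? ?]; apply/andP; split; lra.
have mB : measurable (A `&` ball x r) by apply: measurableI => //; exact: measurable_ball.
have mI : measurable I by exact: measurable_itv.
have muI : lebesgue_measure I = ell%:E.
  by rewrite lebesgue_measure_itv /= lte_fin ltrDl ell0 -EFinB addrAC subrr add0r.
have le1 : (lebesgue_measure ((A `&` ball x r) `|` I) <= (r *+ 2)%:E)%E.
  rewrite -(lebesgue_measure_ball x (ltW r0)) le_measure ?inE //.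
  - exact: measurableU.
  - exact: measurable_ball.
  - by rewrite subUset; split => //; exact: subIsetr.
have eq1 : lebesgue_measure ((A `&` ball x r) `|` I)
    = (lebesgue_measure (A `&` ball x r) + lebesgue_measure I)%E by exact: measureU.
move: le1; rewrite eq1 muI; apply/negP; rewrite -ltNge.
apply: (@le_lt_trans _ _ (((1 - del) * (r *+ 2))%:E + ell%:E)%E); last by rewrite lteD2rE.
by rewrite -EFinD lee_fin /ell mulrBl mul1r subrK.
Qed.

(** * Regularity of the Weierstrass function *)

Lemma bounded_of_periodic {R : realType} (g : R -> R) (C : R) :
  (forall (t : R) (m : int), g (t + m%:~R) = g t) ->
  (forall t, 0 <= t <= 1 -> `|g t - g 0| <= C) ->
  forall t, `|g t| <= `|g 0| + C.
Proof.
move=> per hC t; have /andP[h1 h2] := floor_itv t.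
rewrite -(per t (- Num.floor t)) -(subrK (g 0) (g _)).
apply: le_trans (ler_normD _ _) _; rewrite addrC lerD2l hC // intrN.
by move: h2; rewrite intrD => h2; apply/andP; split; lra.
Qed.

Lemma bounded_of_periodic_derivable {R : realType} (g g1 : R -> R) (C : R) :
  (forall (t : R) (m : int), g (t + m%:~R) = g t) ->
  (forall x : R, is_derive x (1 : R) g (g1 x)) -> (forall x, `|g1 x| <= C) ->
  forall t, `|g t| <= `|g 0| + C.
Proof.
move=> per dg hC; apply: bounded_of_periodic => // t /andP[t0 t1].
have [c [_ _ ->]] := mean_value _ _ t 0 dg; rewrite subr0 -[leRHS]mulr1.
by apply: normrM_le; rewrite // ger0_norm.
Qed.

Lemma bounded_of_periodic_holder {R : realType} (g : R -> R) (eps C : R) :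
  0 < eps -> (forall (t : R) (m : int), g (t + m%:~R) = g t) ->
  (forall s t, `|g s - g t| <= C * `|s - t| `^ eps) ->
  forall t, `|g t| <= `|g 0| + C.
Proof.
move=> eps0 per hC; apply: bounded_of_periodic => // t /andP[t0 t1].
have C0 : 0 <= C by have := le_trans (normr_ge0 _) (hC 1 0); rewrite subr0 normr1 powR1 mulr1.
apply: le_trans (hC _ _) _; rewrite subr0 ger0_norm // ler_piMr //.
have : t `^ eps <= 1 `^ eps by apply: ge0_ler_powR; rewrite ?nnegrE // ltW.
by rewrite powR1.
Qed.

Lemma derive1_periodic {R : realType} (g : R -> R) :
  (forall (t : R) (m : int), g (t + m%:~R) = g t) ->
  forall (t : R) (m : int), derive1 g (t + m%:~R) = derive1 g t.
Proof.
move=> per t m; rewrite /derive1 per.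
by under eq_fun do rewrite addrA per.
Qed.

(** The derivative of the lift is a function on the circle, by [Dcircle_lift];
this makes it periodic, and then all bounds follow by periodicity from the
Holder condition on the highest derivatives. *)
Lemma weierstrass_twisted_equation {R : realType} (eps : R) (f : circle R -> circle R)
    (v : circle R -> R) :
  0 < eps < 1 -> circle_map_C 2 eps f -> expanding f -> circle_fun_C 1 eps v ->
  exists lam B H F F1 F2 w w1,
    twisted_equation eps lam B H F F1 F2 w w1 (fun t => weierstrass f v (circle_pi t)).
Proof.
move=> heps [F lift [dF [H1 hF2]]] [lam lam1 exp] [dw [H2 hw1]].
have /andP[eps0 _] := heps.
pose F1 := derive1 F; pose F2 := derive1 F1.
pose w t := v (circle_pi t); pose w1 := derive1 w.
have isF (t : R) : is_derive t (1 : R) F (F1 t).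
  by rewrite /F1 derive1E; apply: derivableP; exact: (dF 0%N).
have isF1 (t : R) : is_derive t (1 : R) F1 (F2 t).
  by rewrite /F2 derive1E; apply: derivableP; exact: (dF 1%N).
have isw (t : R) : is_derive t (1 : R) w (w1 t).
  by rewrite /w1 derive1E; apply: derivableP; exact: (dw 0%N).
have perw (t : R) (m : int) : w (t + m%:~R) = w t by rewrite /w circle_pi_intD.
have DF t : Dcircle f (circle_pi t) = F1 t.
  by apply: Dcircle_lift => //; exact: (dF 0%N).
have perF1 (t : R) (m : int) : F1 (t + m%:~R) = F1 t by rewrite -!DF circle_pi_intD.
have bF2 := bounded_of_periodic_holder _ _ _ eps0 (derive1_periodic _ perF1) hF2.
have bF1 := bounded_of_periodic_derivable _ _ _ perF1 isF1 bF2.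
have bw1 := bounded_of_periodic_holder _ _ _ eps0 (derive1_periodic _ perw) hw1.
have bw := bounded_of_periodic_derivable _ _ _ perw isw bw1.
have expF t : lam <= `|F1 t| by rewrite -DF ltW.
have aE t : weierstrass f v (circle_pi t) =
    - limn (fun N => \sum_(1 <= n < N) weierstrass_term F F1 w t n).
  rewrite /weierstrass; congr (- limn _); apply/funext => N.
  apply: eq_bigr => n _; rewrite /weierstrass_term /w (iter_lift f) //.
  have dFn := is_derive_iter F F1 n t isF.
  rewrite (Dcircle_lift (iter n f) (iter n F)) ?derive1E ?derive_val //.
    by move=> x; exact: iter_lift.
pose Mw := `|w 0| + (`|w1 0| + H2).
pose B := Num.max (Num.max (`|F1 0| + (`|F2 0| + H1)) (`|F2 0| + H1))
  (Num.max (`|w1 0| + H2) (Mw / (lam - 1))).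
exists lam, B, (Num.max H1 H2), F, F1, F2, w, w1; split.
- exact: heps.
- exact: lam1.
- exact: isF.
- exact: isF1.
- exact: isw.
- exact: expF.
- by move=> t; apply: le_trans (bF1 t) _; rewrite !le_max lexx.
- by move=> t; apply: le_trans (bF2 t) _; rewrite !le_max lexx !orbT.
- by move=> t; apply: le_trans (bw1 t) _; rewrite !le_max lexx !orbT.
- move=> t; rewrite aE normrN.
  apply: le_trans (weierstrass_lim_bounded _ _ _ _ _ lam1 expF bw t) _.
  by rewrite !le_max lexx !orbT.
- move=> s t; apply: le_trans (hF2 s t) _.
  by rewrite ler_wpM2r ?powR_ge0 // le_max lexx.
- move=> s t; apply: le_trans (hw1 s t) _.
  by rewrite ler_wpM2r ?powR_ge0 // le_max lexx orbT.
- move=> t; rewrite !aE (weierstrass_sum_lim _ _ _ _ _ lam1 expF bw t).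
  by rewrite opprB mulrN.
- by move=> t m; rewrite circle_pi_intD.
Qed.

Theorem corollary1p7 (R : realType) (eps : R)
    (heps : 0 < eps < 1)
    (f : circle R -> circle R)
    (hf : circle_map_C 2 eps f) (hexp : expanding f)
    (v : circle R -> R) (hv : circle_fun_C 1 eps v)
    (mu : probability (borel_circle R) R)
    (hinv : invariant_measure f mu)
    (hac : mu `<< circle_lebesgue R)
    (hnot : ~ circle_fun_C 1 eps (weierstrass f v)) :
  (forall x : circle R, ~ circle_derivable (weierstrass f v) x) /\
  (forall A : set (borel_circle R), measurable A -> (0 < mu A)%E ->
     ~ lipschitz_in A (weierstrass f v)).
Proof.
have [lam [B [H [F [F1 [F2 [w [w1 E]]]]]]]] :=
  weierstrass_twisted_equation _ _ _ heps hf hexp hv.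
set a := fun t : R => _ in E.
have not_affine : ~ almost_affine a.
  move=> /(slope_holder _ _ _ _ _ _ _ _ _ _ E)[C C0 hC]; apply: hnot.
  exact: C_holder_of_slopes _ _ _ heps C0 (te_periodic _ _ _ _ _ _ _ _ _ _ E) hC.
split=> [x dx|A mA A0 [L lipA]]; apply: not_affine.
  apply: (almost_affine_of_derivable _ (repr x)).
  have -> // : (fun h => a (repr x + h)) = (fun h => weierstrass f v (x + circle_pi h)).
  by apply/funext => h; rewrite /a circle_piD circle_pi_surj.
pose A' : set R := circle_pi @^-1` A.
have mA' : measurable A'.
  by rewrite /A' -[_ @^-1` _]setTI; exact: measurable_circle_pi.
have A'0 : (0 < lebesgue_measure A')%E.
  rewrite lt_neqAle measure_ge0 andbT; apply/eqP => A'0.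
  have mu0 : mu A = 0%E.
    apply: (hac A) => // C mC CA.
    have mC' : measurable (circle_pi @^-1` C : set R).
      by rewrite -[_ @^-1` _]setTI; exact: measurable_circle_pi.
    apply/eqP; rewrite -(@measure_le0 _ _ _ (mrestr (@lebesgue_measure R) (measurable_itv `[0, 1[))).
    rewrite A'0; apply: le_measure; rewrite ?inE //.
      exact: measurableI.
    by move=> x [Cx _]; exact: CA.
  by move: A0; rewrite mu0 ltxx.
have lipA' x y : A' x -> A' y -> `|a x - a y| <= `|L| * `|x - y|.
  move=> Ax Ay; apply: le_trans (lipA _ _ Ax Ay) _.
  apply: le_trans (ler_wpM2r (normr_ge0 _) (ler_norm L)) _.
  by rewrite ler_wpM2l // circle_dist_le.
have [M lipa] := lipschitz_of_dense _ _ _ _ _ _ _ _ _ _ E A' `|L| lipA'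
  (dense_of_positive_measure _ mA' A'0).
exact: almost_affine_of_lipschitz lipa.
Qed.
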